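(* Let $d\ge 2$, $\mu\in\mathbb{S}^{d-1}$, $\kappa \ge 0$, and set $\alpha=\frac{d-1}{2}+\kappa$, $\beta=\frac{d-1}{2}$. Then $$\int_{\mathbb{S}^{d-1}} (1+\mu^\top x)^\kappa \, d\sigma(x) = 2^{\alpha+\beta}\pi^{\beta}\frac{\Gamma(\alpha)}{\Gamma(\alpha+\beta)},$$ so the normalized density of the Power Spherical distribution is $$p_X(x;\mu,\kappa) = \left\{2^{\alpha+\beta}\pi^{\beta}\frac{\Gamma(\alpha)}{\Gamma(\alpha+\beta)}\right\}^{-1}(1+\mu^\top x)^\kappa, \quad x\in\mathbb{S}^{d-1}.$$
   Context: $\mathbb{S}^{d-1}=\{x\in\mathbb{R}^d:\|x\|_2=1\}$ and $\sigma$ denotes the (unnormalized) surface measure on $\mathbb{S}^{d-1}$, of total mass $2\pi^{d/2}/\Gamma(d/2)$. The Power Spherical distribution with direction $\mu$ and concentration $\kappa$ is the probability distribution on $\mathbb{S}^{d-1}$ with density w.r.t. $\sigma$ proportional to $(1+\mu^\top x)^\kappa$. *)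

(* Defs.v *)
From HB Require Import structures.
From mathcomp Require Import all_boot all_order all_algebra.
From mathcomp Require Import all_classical all_reals all_analysis.
Set Implicit Arguments. Unset Strict Implicit. Unset Printing Implicit Defensive.
Import Order.TTheory GRing.Theory Num.Theory.
Import numFieldNormedType.Exports.
Local Open Scope classical_set_scope.
Local Open Scope ring_scope.

Section PS.
Variable R : realType.

Definition Gamma (s : R) : R :=
  fine (\int[lebesgue_measure]_(t in (`]0%R, +oo[%classic : set R))
          ((t `^ (s - 1)) * expR (- t))%:E)%E.

Definition dotv (d : nat) (u v : 'rV[R]_d) : R := \sum_(i < d) u ord0 i * v ord0 i.
Definition enorm (d : nat) (v : 'rV[R]_d) : R := Num.sqrt (dotv v v).

(* Iterated Lebesgue integral over the first n coordinates of a point (nat -> R):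
   coordinate n-1 is integrated outermost. By Tonelli this is the Lebesgue
   integral on R^n for nonnegative measurable integrands. *)
Fixpoint iint (n : nat) (f : (nat -> R) -> \bar R) : \bar R :=
  match n with
  | 0 => f (fun _ => 0)
  | n'.+1 => (\int[lebesgue_measure]_t
                iint n' (fun x => f (fun i => if i == n' then t else x i)))%E
  end.

Definition lebesgue_int_Rd (d : nat) (f : 'rV[R]_d -> \bar R) : \bar R :=
  iint d (fun x => f (\row_(i < d) x i)).

(* Integral over the unit sphere S^{d-1} w.r.t. the (unnormalized) surface measure sigma,
   via the cone-measure identity  int_S g dsigma = d * int_{0<|x|<1} g(x/|x|) dx. *)
Definition sphere_int (d : nat) (g : 'rV[R]_d -> R) : \bar R :=
  ((d%:R)%:E * lebesgue_int_Rd
     (fun v : 'rV[R]_d => if ((0 < enorm v) && (enorm v < 1))%R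
                         then (g ((enorm v)^-1 *: v))%:E else 0%E))%E.

Definition ps_unnorm (d : nat) (mu : 'rV[R]_d) (kappa : R) (x : 'rV[R]_d) : R :=
  (1 + dotv mu x) `^ kappa.

Definition ps_const (d : nat) (kappa : R) : R :=
  let a := (d%:R - 1) / 2 + kappa in
  let b := (d%:R - 1) / 2 in
  (2 `^ (a + b)) * (pi `^ b) * (Gamma a / Gamma (a + b)).

Definition ps_density (d : nat) (mu : 'rV[R]_d) (kappa : R) (x : 'rV[R]_d) : R :=
  (ps_const d kappa)^-1 * ps_unnorm mu kappa x.

End PS.

(* Main.v *)
(* The surface integral is the cone-measure integral over the unit ball.  Shears
   and scalings of two coordinates at a time rotate mu onto the last axis, which
   leaves an integral over (t, y) in R x R^n, n = d - 1, of a function of t and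
   b = t^2 + |y|^2.  Since (1 + t/sqrt b)^kappa is homogeneous of degree 0, its
   integral over the ball, times d Gamma(kappa + n), is the integral of
   (1 + t/r)^kappa r^(kappa-1) e^(-r), with r = sqrt b, over the whole space.
   That one is computed in the parabolic coordinate e^x = r + t, for which
   dt = r dx and r = (e^x + |y|^2 e^(-x))/2: the integral over y becomes
   Gaussian and the remaining one is a Gamma integral. *)
Require Import Defs.
From HB Require Import structures.
From mathcomp Require Import all_boot all_order all_algebra.
From mathcomp Require Import all_classical all_reals all_analysis.
From mathcomp Require Import measurable_realfun ring lra.
Import Order.TTheory GRing.Theory Num.Theory.
Import numFieldNormedType.Exports.
Local Open Scope classical_set_scope.
Local Open Scope ring_scope.

Set Implicit Arguments.
Unset Strict Implicit.
Unset Printing Implicit Defensive.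

(** * Integration over one coordinate of a radial function *)

Section SquareIntegral.
Context {R : realType}.
Local Notation mu := (@lebesgue_measure R).

(** The measure [a] times the pushforward of Lebesgue measure under [x |-> a x + b] gives every
    half-open interval its length, hence is Lebesgue measure. *)
Lemma ge0_integral_affine (f : R -> \bar R) (a b : R) :
  measurable_fun [set: R] f -> (forall x, (0 <= f x)%E) -> 0 < a ->
  (\int[mu]_x f x = a%:E * \int[mu]_x f (a * x + b)%R)%E.
Proof.
move=> mf f0 a0.
pose phi : measurableTypeR R -> measurableTypeR R := fun x => a * x + b.
have mphi : measurable_fun [set: measurableTypeR R] phi.
  by apply: measurable_funD => //; exact: measurable_funM.
transitivity (a%:E * \int[pushforward mu phi]_x f x)%E; last first.
  by rewrite ge0_integral_pushforward.
have a0' : 0 <= a by exact: ltW.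
rewrite -[X in (X%:E * _)%E]/((NngNum a0')%:num) -ge0_integral_mscale//.
apply: eq_measure_integral => A mA _.
apply: lebesgue_measure_unique => // X [[u v]] _ <- /=.
rewrite /mscale /= /pushforward.
have -> : phi @^-1` `]u, v] = `](u - b) / a, (v - b) / a]%classic.
  apply/seteqP; split => x;
    rewrite /= /phi !in_itv /= ltr_pdivrMr// ler_pdivlMr//; lra.
rewrite !lebesgue_measure_itv /= !lte_fin.
rewrite ltr_pM2r ?invr_gt0// ltrD2r.
case: ifP => _; last by rewrite mule0.
rewrite -!EFinB -EFinM; congr (_%:E).
by field; rewrite gt_eqF.
Qed.

(* Iterating [sqint] n times integrates over y in R^n the value of [f] at
   [b + |y|^2]. *)
Definition sqint (f : R -> \bar R) (b : R) : \bar R :=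
  (\int[mu]_t f (b + t ^+ 2)%R)%E.

Lemma sqint_ge0 n (f : R -> \bar R) b :
  (forall x, (0 <= f x)%E) -> (0 <= iter n sqint f b)%E.
Proof.
by move=> f0; elim: n b => [|n IH] b //=; apply: integral_ge0.
Qed.

(** The parameter in [T] stays free because later exchanges of integrals need joint measurability;
    each induction step is measurability of a Tonelli partial integral. *)
Lemma measurable_sqint d (T : measurableType d) n (f : T * R -> \bar R) :
  measurable_fun [set: T * R] f -> (forall x, (0 <= f x)%E) ->
  measurable_fun [set: T * R] (fun z => iter n sqint (fun b => f (z.1, b)) z.2).
Proof.
move=> mf f0; elim: n => [|n IH] /=.
  by apply: eq_measurable_fun mf => -[].
pose g (z : (T * R) * R) :=
  iter n sqint (fun b => f (z.1.1, b)) (z.1.2 + z.2 ^+ 2).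
apply: (@measurable_fun_fubini_tonelli_F _ _ _ _ _ mu g).
- apply: (measurableT_comp (g :=
    fun z : (T * R) * R => (z.1.1, z.1.2 + z.2 ^+ 2))
  IH).
  apply: measurable_fun_pair => /=; first exact: measurableT_comp.
  apply: measurable_funD => //; first exact: measurableT_comp.
  exact: measurable_funX.
- by move=> z; exact: sqint_ge0.
Qed.

Lemma measurable_sqint1 n (f : R -> \bar R) :
  measurable_fun [set: R] f -> (forall x, (0 <= f x)%E) ->
  measurable_fun [set: R] (iter n sqint f).
Proof.
move=> mf f0.
have mg : measurable_fun [set: unit * R] (f \o snd).
  exact: measurableT_comp.
apply: (measurableT_comp (g :=
  fun x : R => (tt, x)) (measurable_sqint n mg (fun z => f0 z.2))).
exact: measurable_pair1.
Qed.

Lemma sqint_translate n (f : R -> \bar R) c b :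
  iter n sqint (fun x => f (x + c)) b = iter n sqint f (b + c).
Proof.
elim: n b => [//|n IH] b /=.
by apply: eq_integral => t _; rewrite IH addrAC.
Qed.

Lemma sqintZl n (f : R -> \bar R) (c : \bar R) b :
  measurable_fun [set: R] f -> (forall x, (0 <= f x)%E) -> (0 <= c)%E ->
  iter n sqint (fun x => c * f x)%E b = (c * iter n sqint f b)%E.
Proof.
move=> mf f0 c0; elim: n b => [//|n IH] b /=.
rewrite /sqint -ge0_integralZl//; last 2 first.
- apply: (measurableT_comp (g := fun t : R => b + t ^+ 2)
  (measurable_sqint1 n mf f0)).
  by apply: measurable_funD => //; exact: measurable_funX.
- by move=> t _; exact: sqint_ge0.
by apply: eq_integral => t _; rewrite IH.
Qed.

(** Each of the [n] substitutions [t |-> s t] contributes a factor [s], as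
    [s^2 b + (s t)^2 = s^2 (b + t^2)]. *)
Lemma sqint_scale n (f : R -> \bar R) (s b : R) :
  measurable_fun [set: R] f -> (forall x, (0 <= f x)%E) -> 0 < s ->
  iter n sqint f (s ^+ 2 * b) =
  ((s ^+ n)%:E * iter n sqint (fun x => f (s ^+ 2 * x)%R) b)%E.
Proof.
move=> mf f0 s0; elim: n b => [|n IH] b /=; first by rewrite mul1e.
rewrite [LHS](@ge0_integral_affine _ s 0)//; last 2 first.
- apply: (measurableT_comp (g := fun t : R => s ^+ 2 * b + t ^+ 2)
  (measurable_sqint1 n mf f0)).
  by apply: measurable_funD => //; exact: measurable_funX.
- by move=> t; exact: sqint_ge0.
rewrite (exprS s n) EFinM -muleA; congr (_ * _)%E.
rewrite [in RHS]/sqint -ge0_integralZl//; last 3 first.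
- apply: (measurableT_comp (g := fun t : R => b + t ^+ 2) ).
    apply: measurable_sqint1 => //.
    apply: (measurableT_comp (g := fun x : R => s ^+ 2 * x) mf).
    exact: measurable_funM.
  by apply: measurable_funD => //; exact: measurable_funX.
- by move=> t _; exact: sqint_ge0.
- by rewrite lee_fin exprn_ge0// ltW.
by apply: eq_integral => t _; rewrite -IH addr0 exprMn -mulrDr.
Qed.

Lemma sqint_swap n (f : R * R -> \bar R) b :
  measurable_fun [set: R * R] f -> (forall z, (0 <= f z)%E) ->
  iter n sqint (fun x => \int[mu]_s f (s, x))%E b =
  (\int[mu]_s iter n sqint (fun x => f (s, x)) b)%E.
Proof.
move=> mf f0; elim: n b => [//|n IH] b /=.
rewrite /sqint.
under eq_integral => t _ do rewrite IH.
apply: (fubini_tonelli (m1 := mu) (m2 := mu)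
  (fun z : R * R => iter n sqint (fun x => f (z.2, x)) (b + z.1 ^+ 2))) => /=.
- apply: (measurableT_comp (g := fun z : R * R => (z.2, b + z.1 ^+ 2))
  (measurable_sqint n mf f0)).
  apply: measurable_fun_pair => //=.
  by apply: measurable_funD => //; exact: measurable_funX.
- by move=> z; exact: sqint_ge0.
Qed.

Lemma eq_sqint_ge0 n (f g : R -> \bar R) :
  (forall x, 0 <= x -> f x = g x) ->
  forall b, 0 <= b -> iter n sqint f b = iter n sqint g b.
Proof.
move=> fg; elim: n => [//|n IH] b b0 /=.
by apply: eq_integral => t _; rewrite IH// addr_ge0// sqr_ge0.
Qed.

(** For [x >= 0] the sum [x + t^2] vanishes at most at [t = 0], a null set for the innermost
    integral. Formulas containing [ln b] can thus be compared for [b > 0] alone. *)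
Lemma eq_sqint_gt0 n (f g : R -> \bar R) :
  measurable_fun [set: R] f -> measurable_fun [set: R] g ->
  (forall x, 0 < x -> f x = g x) ->
  forall b, 0 <= b -> iter n.+1 sqint f b = iter n.+1 sqint g b.
Proof.
move=> mf mg fg; rewrite !iterSr; apply: eq_sqint_ge0 => x x0.
rewrite /sqint -[LHS](@integral_setD1 _ _ 0)//; last 2 first.
- exact: measurableD.
- apply: measurable_funTS.
  apply: (measurableT_comp (g := fun t : R => x + t ^+ 2) mf).
  by apply: measurable_funD => //; exact: measurable_funX.
rewrite -[RHS](@integral_setD1 _ _ 0)//; last 2 first.
- exact: measurableD.
- apply: measurable_funTS.
  apply: (measurableT_comp (g := fun t : R => x + t ^+ 2) mg).
  by apply: measurable_funD => //; exact: measurable_funX.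
apply: eq_integral => t /[!inE] -[_ /= /eqP t0]; apply: fg.
by rewrite ltr_wpDl// exprn_even_gt0.
Qed.

Lemma sqint_expR n (c b : R) : 0 < c ->
  iter n sqint (fun x => (expR (- (c * x)))%:E) b =
  (Num.sqrt (pi / c) ^+ n * expR (- (c * b)))%:E.
Proof.
move=> c0; elim: n b => [|n IH] b /=; first by rewrite mul1r.
rewrite /sqint; under eq_integral => t _.
  rewrite IH mulrDr opprD expRD mulrA EFinM; over.
have mE : measurable_fun [set: R] (fun x : R => (expR (- (c * x ^+ 2)))%:E).
  apply/measurable_EFinP; apply: measurableT_comp => //.
  apply: measurableT_comp => //.
  by apply: measurable_funM => //; exact: measurable_funX.
rewrite ge0_integralZl//.
(* Rescaling by [1 / sqrt c] reduces to the standard Gaussian integral, [sqrt pi]. *)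
rewrite (@ge0_integral_affine _ (Num.sqrt c)^-1 0) ?invr_gt0 ?sqrtr_gt0//.
under eq_integral => t _.
  rewrite addr0 exprMn exprVn sqr_sqrtr ?(ltW c0)// mulrA divff ?gt_eqF// mul1r.
  over.
rewrite -[X in (_ * (_ * X))%E]/(\int[mu]_x (gauss_fun x)%:E)%E integralT_gauss.
rewrite -!EFinM sqrtrM ?pi_ge0// sqrtrV ?(ltW c0)// exprS; congr (_%:E); ring.
Qed.

End SquareIntegral.

(** * Rotation of the axis *)

Section Rotation.
Context {R : realType}.
Local Notation mu := (@lebesgue_measure R).

Lemma ge0_integralN (f : R -> \bar R) :
  measurable_fun [set: R] f -> (forall x, (0 <= f x)%E) ->
  (\int[mu]_x f (- x)%R = \int[mu]_x f x)%E.
Proof.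
move=> mf f0.
pose phi : measurableTypeR R -> measurableTypeR R := -%R.
have mphi : measurable_fun [set: measurableTypeR R] phi.
  exact: oppr_measurable.
transitivity (\int[pushforward mu phi]_x f x)%E.
  by rewrite ge0_integral_pushforward.
by apply: eq_measure_integral => A mA _; exact: lebesgue_measureN.
Qed.

(* Shears and scalings only, so that one-dimensional affine substitutions and
   Tonelli suffice. *)
Lemma integral_rotation (f : R * R -> \bar R) (p q : R) :
  measurable_fun [set: R * R] f -> (forall z, (0 <= f z)%E) ->
  (\int[mu]_t \int[mu]_s f (p * s + q * t, s ^+ 2 + t ^+ 2)%R =
   \int[mu]_t \int[mu]_s f (Num.sqrt (p ^+ 2 + q ^+ 2) *
     t, s ^+ 2 + t ^+ 2)%R)%E.
Proof.
move=> mf f0.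
have mfc d (T : measurableType d) (u v : T -> R) : measurable_fun setT u ->
    measurable_fun setT v -> measurable_fun setT (fun x => f (u x, v x)).
  move=> mu_ mv_; apply: (measurableT_comp (g := fun x => (u x, v x)) mf).
  exact: measurable_fun_pair.
have msq d (T : measurableType d) (u v : T -> R) : measurable_fun setT u ->
    measurable_fun setT v -> measurable_fun setT (fun x => u x ^+ 2 + v x ^+ 2).
  by move=> mu_ mv_; apply: measurable_funD; exact: measurable_funX.
have mlin d (T : measurableType d) (u v : T ->
  R) (a b : R) : measurable_fun setT u ->
    measurable_fun setT v -> measurable_fun setT (fun x => a * u x + b * v x).
  by move=> mu_ mv_; apply: measurable_funD; exact: measurable_funM.
wlog p0 : p / 0 <= p => [hwlog|].
  have [/hwlog//|/ltW p0] := leP 0 p.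
  rewrite -(sqrrN p) -(hwlog (- p)); last by rewrite oppr_ge0.
  apply: eq_integral => t _.
  rewrite -ge0_integralN//; last first.
    by apply: mfc; [exact: (mlin _ _ id (cst t))|exact: (msq _ _ id (cst t))].
  by apply: eq_integral => s _; rewrite sqrrN mulrN mulNr.
(* For [p = 0] the axis is already the [t] axis, up to a reflection; the substitutions below divide
   by [p]. *)
have [p00|pn0] := eqVneq p 0.
  rewrite p00 expr0n add0r sqrtr_sqr.
  have [q0|/ltW q0] := leP 0 q.
    by apply: eq_integral => t _; apply: eq_integral => s _;
      rewrite mul0r add0r ger0_norm.
  rewrite -ge0_integralN/=; last 2 first.
  - apply: (@measurable_fun_fubini_tonelli_F _ _ _ _ _ mu
      (fun z : R * R => f (0 * z.2 + q * z.1, z.2 ^+ 2 + z.1 ^+ 2))) => //.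
    by apply: mfc; [exact: mlin|exact: msq].
  - by move=> t; exact: integral_ge0.
  apply: eq_integral => t _; apply: eq_integral => s _.
  by rewrite mul0r add0r ler0_norm// sqrrN mulrN mulNr.
have {pn0 p0} p0 : 0 < p by rewrite lt_neqAle eq_sym pn0.
set r := Num.sqrt _.
have r2 : r ^+ 2 = p ^+ 2 + q ^+ 2 by rewrite sqr_sqrtr// addr_ge0// sqr_ge0.
have r0 : 0 < r by rewrite sqrtr_gt0 ltr_wpDr ?sqr_ge0// exprn_gt0.
have pn : p != 0 by rewrite gt_eqF.
have rn : r != 0 by rewrite gt_eqF.
pose g (z : R * R) := f (z.2, (p^-1 * z.2 + (- (q / p)) * z.1) ^+ 2 + z.1 ^+ 2).
have mg : measurable_fun [set: R * R] g.
  by apply: mfc => //; apply: msq => //; exact: mlin.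
have g0 z : (0 <= g z)%E by exact: f0.
(* The substitution [w = p s + q t] turns the quadratic form into
   [(r / p)^2 (t - q w / r^2)^2 + w^2 / r^2], which is then completed in [t]. *)
transitivity (p^-1%:E * \int[mu]_t \int[mu]_w g (t, w))%E.
  rewrite -ge0_integralZl//; last 3 first.
  - exact: (measurable_fun_fubini_tonelli_F (m2 := mu) g).
  - by move=> t _; apply: integral_ge0 => w _; exact: f0.
  - by rewrite lee_fin invr_ge0 ltW.
  apply: eq_integral => t _.
  rewrite (@ge0_integral_affine _ _ p^-1 (- (q / p) * t)) ?invr_gt0//;
    last first.
    by apply: mfc; [exact: (mlin _ _ id (cst t))|exact: (msq _ _ id (cst t))].
  congr (_ * _)%E; apply: eq_integral => w _; rewrite /g /=; congr (f (_, _)).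
  by field.
rewrite (fubini_tonelli (m1 := mu) (m2 := mu))//.
(* [k (w, s)] is the integrand after [t = (p / r) s + q w / r^2]; the Jacobians [1 / p] and [p / r]
   combine to [1 / r]. *)
pose k (z : R * R) := f (z.1, (z.2 ^+ 2 + (r^-1 * z.1) ^+ 2)).
have mk : measurable_fun [set: R * R] k.
  by apply: mfc => //; apply: msq => //; exact: measurable_funM.
have k0 z : (0 <= k z)%E by exact: f0.
transitivity (r^-1%:E * \int[mu]_w \int[mu]_s k (w, s))%E.
  rewrite -[LHS]ge0_integralZl//; last 3 first.
  - exact: (measurable_fun_fubini_tonelli_G (m1 := mu) g).
  - by move=> t _; apply: integral_ge0 => w _; exact: g0.
  - by rewrite lee_fin invr_ge0 ltW.
  have rV0 : (0 <= r^-1%:E)%E by rewrite lee_fin invr_ge0 ltW.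
  rewrite -[RHS]ge0_integralZl; [|by []| | |exact: rV0]; last 2 first.
  - exact: (measurable_fun_fubini_tonelli_F (m2 := mu) k).
  - by move=> w _; exact: integral_ge0.
  apply: eq_integral => w _.
  rewrite [in LHS](@ge0_integral_affine _ _ (p / r) (q *
    w / r ^+ 2)) ?divr_gt0//; last first.
    apply: (measurableT_comp (g := fun t : R => (t, w)) mg).
    exact: measurable_pair2.
  rewrite muleA -EFinM mulrA mulVf// mul1r; congr (_ * _)%E.
  apply: eq_integral => s _; rewrite /g /k /=; congr (f (_, _)).
  have qE : q ^+ 2 = r ^+ 2 - p ^+ 2 by rewrite r2; ring.
  rewrite exprMn.
  (* [field] does not know that [r^2 = p^2 + q^2]. This form displays the combinations of [q^2] that
     simplify after [qE]; the cross term then vanishes. *)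
  transitivity ((p / r * s) ^+ 2 * (q ^+ 2 + p ^+ 2) / p ^+ 2 
     + 2 * (p / r * s) * (q * w / r^+2) * ((q ^+ 2 + p ^+ 2) - r ^+ 2) / p ^+ 2
     + w ^+ 2 / p ^+ 2 * (1 - 2 * q ^+ 2 / r ^+ 2 + q^+2 / r^+ 4 *
         (q ^+ 2 + p ^+ 2))).
    by field; rewrite rn pn.
  by rewrite qE; field; rewrite rn pn.
rewrite (@ge0_integral_affine _ _ r 0)//; last 2 first.
- exact: (measurable_fun_fubini_tonelli_F (m2 := mu) k).
- by move=> t; apply: integral_ge0 => w _; exact: f0.
rewrite muleA -EFinM mulVf// mul1e; apply: eq_integral => t _.
by apply: eq_integral => s _; rewrite /k /= addr0 mulKf.
Qed.

Lemma iintS n (f : (nat -> R) -> \bar R) :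
  iint n.+1 f =
  (\int[mu]_t iint n (fun x => f (fun i => if i == n then t else x i)))%E.
Proof. by []. Qed.

(* Each induction step merges the newest coordinate with the axis direction
   obtained so far by one planar rotation. *)
Lemma iint_rotation n (m : nat -> R) (h : R * R -> \bar R) :
  measurable_fun [set: R * R] h -> (forall z, (0 <= h z)%E) ->
  iint n.+1 (fun x => h (\sum_(i < n.+1) m i * x i, \sum_(i < n.+1) x i ^+ 2)) =
  (\int[mu]_t iter n sqint
    (fun b => h (Num.sqrt (\sum_(i < n.+1) m i ^+ 2) * t, b)%R) (t ^+ 2)%R)%E.
Proof.
elim: n h => [|n IH] h mh h0.
  rewrite /= big_ord1 sqrtr_sqr.
  have [m0|/ltW m0] := leP 0 (m 0%N).
    by apply: eq_integral => t _; rewrite !big_ord1 ger0_norm.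
  rewrite -ge0_integralN//.
    by apply: eq_integral => t _;
      rewrite !big_ord1 ler0_norm// sqrrN mulrN mulNr.
  apply: (measurableT_comp (g := fun x => (_, _)) mh).
  under eq_fun do rewrite !big_ord1/=.
  by apply: measurable_fun_pair;
    [exact: measurable_funM|exact: measurable_funX].
rewrite iintS.
pose F (z : R * R) := iter n sqint (fun b => h (z.1, b)) z.2.
have mF : measurable_fun [set: R * R] F by exact: measurable_sqint.
have F0 z : (0 <= F z)%E by exact: sqint_ge0.
pose r := Num.sqrt (\sum_(i < n.+1) m i ^+ 2).
transitivity (\int[mu]_t \int[mu]_s F (r * s + m n.+1 *
  t, s ^+ 2 + t ^+ 2)%R)%E.
  apply: eq_integral => t _.
  (* The newest coordinate [t] is absorbed into both arguments of [h], so that the induction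
     hypothesis applies to the others. *)
  pose ht (z : R * R) := h (z.1 + m n.+1 * t, z.2 + t ^+ 2).
  transitivity (iint n.+1 (fun x => ht (\sum_(i < n.+1) m i *
    x i, \sum_(i < n.+1) x i ^+ 2))).
    congr (iint _ _); apply/funext => x; rewrite /ht /=.
    rewrite !(big_ord_recr n.+1) /= !eqxx.
    by congr (h (_ + _, _ + _)); apply: eq_bigr => i _;
      rewrite (ltn_eqF (ltn_ord i)).
  rewrite IH.
  - apply: eq_integral => s _.
    by rewrite -[RHS](sqint_translate n (fun b => h (r * s + m n.+1 * t, b))).
  - apply: (measurableT_comp (g :=
      fun z : R * R => (z.1 + m n.+1 * t, z.2 + t ^+ 2))
    mh).
    by apply: measurable_fun_pair => /=; exact: measurable_funD.
  - by move=> z; exact: h0.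
rewrite (integral_rotation r (m n.+1) mF F0).
apply: eq_integral => t _; rewrite /= /sqint; apply: eq_integral => s _.
rewrite (addrC (s ^+ 2)) /F /= big_ord_recr /=.
by rewrite /r sqr_sqrtr// sumr_ge0// => i _; exact: sqr_ge0.
Qed.

End Rotation.

(** * Substitution and the Gamma function *)

Section Substitution.
Context {R : realType}.
Local Notation mu := (@lebesgue_measure R).

(** On compact intervals this is the usual substitution rule. The intervals [[-n, n]] exhaust the
    line and their images exhaust the range of [F], so monotone convergence passes to the limit on
    both sides. *)
Lemma ge0_integration_by_substitution_range (F G : R -> R) :
  {homo F : x y / x < y} -> (forall x, derivable F x 1) ->
    continuous F^`()%classic ->
  {in range F, continuous G} -> (forall x, 0 <= G x) ->
  (\int[mu]_(x in range F) (G x)%:E =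
    \int[mu]_x (G (F x) * F^`()%classic x)%:E)%E.
Proof.
move=> incF dF cF' cG G0.
have cF : continuous F.
  by move=> x; exact/differentiable_continuous/derivable1_diffP/dF.
have leF : {homo F : x y / x <= y} by exact: ltW_homo.
have nn n : (- n%:R <= n%:R :> R) by rewrite -subr_ge0 opprK addr_ge0.
have sub n : `[F (- n%:R), F n%:R]%classic `<=` range F.
  move=> y /= yF.
  have [||x _ xy] := @IVT _ F (- n%:R) n%:R y (nn n); last by exists x.
  - exact: continuous_subspaceT.
  - by move: yF; rewrite in_itv /= (min_idPl _) ?(max_idPr _) ?leF.
have mono (a b : nat -> R) : (forall m n, (m <= n)%N ->
  a n <= a m /\ b m <= b n) ->
    nondecreasing_seq (fun n => `[a n, b n]%classic).
  move=> ab m n mn; rewrite subsetEset => x /=.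
  have [? ?] := ab _ _ mn.
  by rewrite !in_itv /= => /andP[? ?]; apply/andP; split; lra.
have cover (x : R) : exists n : nat, - n%:R <= x <= n%:R.
  exists (Num.truncn `|x|).+1; rewrite -ler_norml; apply: ltW.
  by rewrite truncnS_gt.
have unionT : \bigcup_n `[- n%:R, n%:R]%classic = [set: R].
  by apply/seteqP; split => // x _; have [n xn] := cover x; exists n => //=;
    rewrite in_itv.
have unionF : \bigcup_n `[F (- n%:R), F n%:R]%classic = range F.
  apply/seteqP; split => [y [n _ yF]|_ [x _ <-]]; first exact: (sub n).
  have [n /andP[nx xn]] := cover x.
  by exists n => //=; rewrite in_itv /= !leF.
have mGF : measurable_fun [set: R] (fun x => (G (F x) * F^`()%classic x)%:E).
  suff cGF : continuous (fun x => G (F x) * F^`()%classic x).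
    by apply/measurable_EFinP; exact: continuous_measurable_fun.
  move=> x; apply: cvgM; last exact: cF'.
  apply: (@continuous_comp _ _ _ F G x); first exact: cF.
  by apply: cG; rewrite inE; exists x.
have cvgl : (\int[mu]_(x in [set` `[F (- n%:R)%R, F n%:R%R]%R])
  (G x)%:E)%E @[n --> \oo] -->
    (\int[mu]_(x in range F) (G x)%:E)%E.
  rewrite -unionF; apply: ge0_nondecreasing_set_cvg_integral.
  - by apply: mono => m n mn; split; apply: leF; rewrite ?lerN2 ler_nat.
  - by move=> n; exact: measurable_itv.
  - move=> n; apply/measurable_EFinP.
    apply: subspace_continuous_measurable_fun; first exact: measurable_itv.
    by apply: continuous_in_subspaceT => x /[!inE] /sub xF; apply: cG;
      rewrite inE.
  - by move=> n x _; rewrite lee_fin.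
have cvgr : (\int[mu]_(x in [set` `[(- n%:R)%R, n%:R%R]%R]) (G (F x) *
  F^`()%classic x)%:E)%E @[n --> \oo] -->
    (\int[mu]_x (G (F x) * F^`()%classic x)%:E)%E.
  rewrite -unionT; apply: ge0_nondecreasing_set_cvg_integral.
  - by apply: mono => m n mn; split; rewrite ?lerN2 ler_nat.
  - by move=> n; exact: measurable_itv.
  - by move=> n; exact: measurable_funTS.
  - move=> n x _; rewrite lee_fin mulr_ge0//.
    by apply: (@incr_derive1_ge0 _ _ setT) => //; [move=> *;
      exact: incF|rewrite interiorT].
apply: cvg_unique cvgl _ => //.
apply: cvg_trans cvgr; apply: near_eq_cvg; near=> n.
rewrite -integration_by_substitution_increasing//.
- by move=> x y _ _; exact: incF.
- by apply/cvg_ex; eexists; apply: cvg_at_right_filter; exact: cF'.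
- by apply/cvg_ex; eexists; apply: cvg_at_left_filter; exact: cF'.
- split; first by move=> x _; exact: dF.
  + by apply: cvg_at_right_filter; exact: cF.
  + by apply: cvg_at_left_filter; exact: cF.
- by apply: continuous_in_subspaceT => x /[!inE] /sub xF; apply: cG;
    rewrite inE.
Unshelve. all: by end_near. Qed.

(* The Gamma integral in the variable [x = ln t]; unlike [Gamma] it is not
   truncated by [fine], so it may be [+oo]. *)
Definition expGamma (s : R) : \bar R :=
  (\int[mu]_x (expR (s * x - expR x))%:E)%E.

Lemma derive1_expR : (@expR R)^`()%classic = expR.
Proof.
apply/funext => x; rewrite derive1E.
exact: (congr1 (@^~ x) (@derive_expR R)).
Qed.

Lemma range_expR : range (@expR R) = `]0, +oo[%classic.
Proof.
apply/seteqP; split => [_ [x _ <-]|y] /=; first by rewrite in_itv /= expR_gt0.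
by rewrite in_itv /= andbT => y0; exists (ln y) => //; rewrite lnK.
Qed.

(** With [t = expR x], the Jacobian [expR x] raises the power [s - 1] of [t] to [s]. *)
Lemma GammaE (s : R) : Gamma s = fine (expGamma s).
Proof.
pose G (t : R) := t `^ (s - 1) * expR (- t).
rewrite /Gamma -range_expR (@ge0_integration_by_substitution_range _ G).
- congr fine; apply: eq_integral => x _; congr (_%:E).
  rewrite /G derive1_expR -expRM.
  by rewrite -!expRD; congr expR; ring.
- by move=> x y; rewrite ltr_expR.
- exact: derivable_expR.
- by rewrite derive1_expR; exact: continuous_expR.
- move=> x /[!inE]; rewrite range_expR => x0.
  have cp : {for x, continuous (@powR R ^~ (s - 1))}.
    apply/differentiable_continuous/derivable1_diffP; apply: derivable_powR.
    by move: x0; rewrite inE.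
  apply: cvgM; first exact: cp.
  by apply: (@continuous_comp _ _ _ -%R expR);
    [exact: opp_continuous|exact: continuous_expR].
- by move=> x; rewrite mulr_ge0 ?powR_ge0 ?expR_ge0.
Qed.

End Substitution.

(** * Finiteness and positivity of the Gamma integral *)

Section GammaBounds.
Context {R : realType}.
Local Notation mu := (@lebesgue_measure R).

Lemma measurable_expRB (a : R) (u : R -> R) : measurable_fun [set: R] u ->
  measurable_fun [set: R] (fun x => (expR (a * x - u x))%:E).
Proof.
move=> mu_; apply/measurable_EFinP; apply: measurableT_comp => //.
by apply: measurable_funB => //; exact: measurable_funM.
Qed.

(** A translation of [x] by [- ln c] absorbs the factor [c]. *)
Lemma expGamma_scale (s c : R) : 0 < c ->
  (\int[mu]_x (expR (s * x - c * expR x))%:E = (c `^ (- s))%:E * expGamma s)%E.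
Proof.
move=> c0; rewrite (@ge0_integral_affine _ _ 1 (- ln c))//; last first.
  by apply: measurable_expRB; exact: measurable_funM.
rewrite mul1e /expGamma -ge0_integralZl//; last 2 first.
- exact: measurable_expRB.
- by rewrite lee_fin powR_ge0.
apply: eq_integral => x _; rewrite -EFinM; congr (_%:E).
rewrite /powR gt_eqF// -expRD; congr expR.
by rewrite mul1r expRD expRN lnK ?posrE//; field; rewrite gt_eqF.
Qed.

(** At [s = 1], the substitution [u = expR x] gives the exponential density integrated over the
    positive half-line, at most its total mass. Finiteness of [expGamma] rests on this bound. *)
Lemma expGamma1_le1 : (@expGamma R 1 <= 1)%E.
Proof.
rewrite -(@integral_exponential_pdf R 1)//.
rewrite /expGamma.
under eq_integral => x _ do rewrite mul1r addrC expRD -{3}derive1_expR.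
rewrite -(@ge0_integration_by_substitution_range R expR (fun t => expR (- t))).
- rewrite range_expR.
  have -> : (\int[mu]_(x in `]0%R, +oo[) (expR (- x))%:E =
      \int[mu]_(x in `]0%R, +oo[) (exponential_pdf 1 x)%:E)%E.
    apply: eq_integral => x; rewrite inE /= in_itv /= andbT => x0.
    by rewrite exponential_pdfE ?ltW// mul1r mulN1r.
  apply: ge0_subset_integral => //.
  + by apply/measurable_EFinP; exact: measurable_exponential_pdf.
  + by move=> x _; rewrite lee_fin exponential_pdf_ge0.
- by move=> x y; rewrite ltr_expR.
- exact: derivable_expR.
- by rewrite derive1_expR; exact: continuous_expR.
- by move=> x _; apply: (@continuous_comp _ _ _ -%R expR);
    [exact: opp_continuous|exact: continuous_expR].
- by move=> x; exact: expR_ge0.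
Qed.

(** Comparison with [s = 1]: for [b = min s 1] the integrand is at most a constant times
    [expR (b x - expR (b x) / 2)], whose integral becomes a multiple of [expGamma 1] after scaling
    and translating [x]. *)
Lemma expGamma_lty (s : R) : 0 < s -> (expGamma s < +oo)%E.
Proof.
move=> s0; pose b := Num.min s 1.
have b0 : 0 < b by rewrite lt_min s0 ltr01.
have bs : b <= s by rewrite ge_min lexx.
have b1 : b <= 1 by rewrite ge_min lexx orbT.
have [C C0 HC] : exists2 C, 1 <= C & forall x, (s - b) * x <= C + expR x / 2.
  have [sb|sb] := leP (s - b) 0.
    have -> : s - b = 0 by apply/eqP; rewrite eq_le sb subr_ge0.
    by exists 1 => // x; rewrite mul0r addr_ge0// divr_ge0// expR_ge0.
  (* The tangent to [expR x / 2] at [c] has slope [s - b], and the convex function lies above it. *)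
  pose c := ln (2 * (s - b)).
  exists (1 + `|(s - b) * (c - 1)|); first by rewrite lerDl.
  move=> x; have := expR_ge1Dx (x - c).
  rewrite expRB lnK ?posrE ?mulr_gt0// => H.
  have {}H : (1 + (x - c)) * (2 * (s - b)) <= expR x.
    by rewrite -ler_pdivlMr// mulr_gt0.
  have := ler_norm ((s - b) * (c - 1)); lra.
have le (x : R) : expR (s * x - expR x) <= expR (C + 1) * expR (b *
  x - 2^-1 * expR (b * x)).
  rewrite -expRD ler_expR.
  (* For [x >= 0], [HC] and [b <= 1] give the bound; for [x < 0], the terms [(s - b) x] and
     [expR (b x)] are at most 0 and 1. *)
  have [x0|x0] := leP 0 x.
    have : expR (b * x) <= expR x by rewrite ler_expR ler_piMl.
    by have := HC x; lra.
  have : expR (b * x) <= 1 by rewrite expR_le1 pmulr_rle0// ltW.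
  have : (s - b) * x <= 0 by rewrite mulr_ge0_le0 ?subr_ge0// ltW.
  have := expR_ge0 x; lra.
have mb : measurable_fun [set: R] (fun x => (expR (b * x - 2^-1 * expR (b *
  x)))%:E).
  by apply: measurable_expRB; apply: measurable_funM => //;
    apply: measurableT_comp.
apply: le_lt_trans (_ : (\int[mu]_x ((expR (C + 1))%:E * (expR (b *
  x - 2^-1 * expR (b * x)))%:E) < +oo))%E.
  apply: ge0_le_integral => //.
  - exact: measurable_expRB.
  - exact: emeasurable_funM.
  - by move=> x _; rewrite -EFinM lee_fin.
rewrite ge0_integralZl//.
rewrite (@ge0_integral_affine _ _ b^-1 0) ?invr_gt0//.
have -> : (\int[mu]_x (expR (b * (b^-1 * x + 0) - 2^-1 * expR (b * (b^-1 *
  x + 0))))%:E =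
    \int[mu]_x (expR (1 * x - 2^-1 * expR x))%:E)%E.
  by apply: eq_integral => x _; rewrite addr0 mulVKf ?gt_eqF// mul1r.
rewrite expGamma_scale ?invr_gt0//.
rewrite !lte_mul_pinfty ?lee_fin ?expR_ge0 ?invr_ge0 ?(ltW b0) ?powR_ge0//.
exact: le_lt_trans expGamma1_le1 (ltry _).
Qed.

(** On [[0, 1]] the integrand is bounded below by a positive constant. *)
Lemma expGamma_gt0 (s : R) : (0 < expGamma s)%E.
Proof.
have ms : measurable_fun [set: R] (fun x => (expR (s * x - expR x))%:E).
  exact: measurable_expRB.
apply: (@lt_le_trans _ _ (\int[mu]_(x in `[0%R, 1%R]) (expR (s *
  x - expR x))%:E)%E); last first.
  exact: ge0_subset_integral.
apply: (@lt_le_trans _ _ (\int[mu]_(x in `[0%R, 1%R]) (expR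
  (- `|s| - expR 1))%:E)%E).
  rewrite integral_cst//= lebesgue_measure_itv/= lte_fin ltr01 oppr0 adde0.
  by rewrite mule1 lte_fin expR_gt0.
apply: ge0_le_integral => //.
- exact: measurable_funTS.
- move=> x; rewrite /= in_itv /= => /andP[x0 x1];
    rewrite lee_fin ler_expR lerB ?ler_expR//.
  have : `|s * x| <= `|s| by rewrite normrM ler_piMr// ger0_norm.
  by rewrite ler_norml => /andP[].
Qed.

Lemma Gamma_gt0 (s : R) : 0 < s -> 0 < Gamma s.
Proof.
by move=> s0; rewrite GammaE fine_gt0// expGamma_gt0 expGamma_lty.
Qed.

Lemma EFin_Gamma (s : R) : 0 < s -> (Gamma s)%:E = expGamma s.
Proof.
move=> s0; rewrite GammaE fineK// ge0_fin_numE ?expGamma_lty//.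
exact/ltW/expGamma_gt0.
Qed.

End GammaBounds.

(** * Axially symmetric integrals *)

Section AxialIntegral.
Context {R : realType}.
Local Notation mu := (@lebesgue_measure R).

(* The integral over (t, y) in R x R^n of [h (t, t ^+ 2 + |y|^2)]. *)
Definition axial_int n (h : R * R -> \bar R) : \bar R :=
  (\int[mu]_t iter n sqint (fun b => h (t, b)) (t ^+ 2)%R)%E.

Lemma measurable_axial_integrand n (h : R * R -> \bar R) :
  measurable_fun [set: R * R] h -> (forall z, (0 <= h z)%E) ->
  measurable_fun [set: R] (fun t => iter n sqint (fun b => h (t, b)) (t ^+ 2)).
Proof.
move=> mh h0.
apply: (measurableT_comp (g := fun t : R => (t, t ^+ 2))
  (measurable_sqint n mh h0)).
by apply: measurable_fun_pair => //; exact: measurable_funX.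
Qed.

Lemma measurable_pairl (h : R * R -> \bar R) (t : R) :
  measurable_fun [set: R * R] h -> measurable_fun [set: R] (fun b => h (t, b)).
Proof.
move=> mh; apply: (measurableT_comp (g := fun b : R => (t, b)) mh).
exact: measurable_pair1.
Qed.

Lemma axial_intZl n (h : R * R -> \bar R) (c : \bar R) :
  measurable_fun [set: R * R] h -> (forall z, (0 <= h z)%E) -> (0 <= c)%E ->
  axial_int n (fun z => c * h z)%E = (c * axial_int n h)%E.
Proof.
move=> mh h0 c0; rewrite /axial_int -ge0_integralZl//; last 2 first.
- exact: measurable_axial_integrand.
- by move=> t _; exact: sqint_ge0.
by apply: eq_integral => t _; rewrite -sqintZl//; exact: measurable_pairl.
Qed.

Lemma eq_axial_int n (h k : R * R -> \bar R) :
  measurable_fun [set: R * R] h -> measurable_fun [set: R * R] k ->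
  (forall a b, 0 < b -> h (a, b) = k (a, b)) ->
  axial_int n.+1 h = axial_int n.+1 k.
Proof.
move=> mh mk hk; apply: eq_integral => t _.
by apply: eq_sqint_gt0; rewrite ?sqr_ge0//; try exact: measurable_pairl;
  move=> b /hk.
Qed.

Lemma axial_int_scale n (h : R * R -> \bar R) (s : R) :
  measurable_fun [set: R * R] h -> (forall z, (0 <= h z)%E) -> 0 < s ->
  axial_int n h =
  ((s ^+ n.+1)%:E * axial_int n (fun z => h (s * z.1, s ^+ 2 * z.2)%R))%E.
Proof.
move=> mh h0 s0; rewrite /axial_int (@ge0_integral_affine _ _ s 0)//;
  last 2 first.
- exact: measurable_axial_integrand.
- by move=> t; exact: sqint_ge0.
have mhs : measurable_fun [set: R * R] (fun z => h (s * z.1, s ^+ 2 * z.2)).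
  apply: (measurableT_comp (g := fun z : R * R => (s * z.1, s ^+ 2 * z.2)) mh).
  by apply: measurable_fun_pair => //=; exact: measurable_funM.
rewrite exprS EFinM -muleA; congr (_ * _)%E.
rewrite -ge0_integralZl//; last 3 first.
- exact: (measurable_axial_integrand n mhs).
- by move=> t _; exact: sqint_ge0.
- by rewrite lee_fin exprn_ge0// ltW.
apply: eq_integral => t _; rewrite addr0 exprMn sqint_scale//.
exact: measurable_pairl.
Qed.

Lemma axial_int_swap n (h : R * (R * R) -> \bar R) :
  measurable_fun [set: R * (R * R)] h -> (forall z, (0 <= h z)%E) ->
  axial_int n (fun z => \int[mu]_x h (x, z))%E =
  (\int[mu]_x axial_int n (fun z => h (x, z)))%E.
Proof.
move=> mh h0; rewrite /axial_int.
under eq_integral => t _.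
  rewrite (@sqint_swap R n (fun z => h (z.1, (t, z.2))))//; first over.
  apply: (measurableT_comp (g := fun z : R * R => (z.1, (t, z.2))) mh).
  by apply: measurable_fun_pair => //=; apply: measurable_fun_pair.
(* Regrouping makes [(x, t)] the parameter and leaves the squared radius last, the form taken by
   [measurable_sqint]. *)
pose k (z : (R * R) * R) := h (z.1.1, (z.1.2, z.2)).
have mk : measurable_fun [set: (R * R) * R] k.
  apply: (measurableT_comp (g := fun z : (R * R) * R => (z.1.1, (z.1.2, z.2)))
    mh).
  apply: measurable_fun_pair => /=; first exact: measurableT_comp.
  by apply: measurable_fun_pair => //=; exact: measurableT_comp.
apply: (fubini_tonelli (m1 := mu) (m2 := mu)
  (fun z : R * R => iter n sqint (fun b => k ((z.2, z.1), b))
    (z.1 ^+ 2))) => /=.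
- apply: (measurableT_comp (g :=
    fun z : R * R => ((z.2, z.1), z.1 ^+ 2)) (measurable_sqint n mk
      (fun z => h0 _))).
  apply: measurable_fun_pair => /=; first exact: measurable_fun_pair.
  exact: measurable_funX.
- by move=> z; apply: sqint_ge0 => b; exact: h0.
Qed.

Lemma half_ln_scale (s b : R) : 0 < s -> 0 < b ->
  ln (s ^+ 2 * b) / 2 = ln s + ln b / 2.
Proof.
by move=> s0 b0; rewrite lnM ?posrE ?exprn_gt0// lnXn//; field.
Qed.

(** For [b > 0], the logarithm of the radius [sqrt b]; it turns dilations into translations. *)
Let logr (b : R) : R := ln b / 2.

Lemma measurable_logr : measurable_fun [set: R] logr.
Proof. by apply: measurable_funM => //; exact: measurable_ln. Qed.

(* [W] is the radial weight as a function of [ln r], where [r = sqrt z.2]. *)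
Lemma radial_factorization n (g : R * R -> \bar R) (W : R -> \bar R) :
  measurable_fun [set: R * R] g -> (forall z, (0 <= g z)%E) ->
  (forall s a b, 0 < s -> 0 < b -> g (s * a, s ^+ 2 * b)%R = g (a, b)) ->
  measurable_fun [set: R] W -> (forall x, (0 <= W x)%E) ->
  axial_int n.+1 (fun z => g z * W (ln z.2 / 2)%R)%E =
  ((n.+2%:R)%:E *
   axial_int n.+1 (fun z => if (0 < z.2 < 1)%R then g z else 0) *
   \int[mu]_x ((expR (n.+2%:R * x))%:E * W x))%E.
Proof.
move=> mg g0 gs mW W0.
(* [r |-> int Psi (x - ln r) dx] is the constant 1; inserting it and rescaling
   by [expR x] moves the weight from the radius to [x]. *)
pose Psi (y : R) : \bar R :=
  (if 0 < y then n.+2%:R * expR (- (n.+2%:R * y)) else 0)%:E.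
have mPsi : measurable_fun [set: R] Psi.
  apply/measurable_EFinP; apply: measurable_fun_ifT => //;
    first exact: measurable_fun_ltr.
  by apply: measurable_funM => //; apply: measurableT_comp => //;
    apply: measurableT_comp => //; exact: measurable_funM.
have Psi0 y : (0 <= Psi y)%E.
  by rewrite lee_fin; case: ifP => // _; rewrite mulr_ge0// expR_ge0.
(* [Psi] is the exponential density of rate [n.+2%:R] except at 0, where it vanishes; removing that
   point equates the integrals. The strict cut-off matches the open ball. *)
have intPsi c : (\int[mu]_x Psi (x - c)%R = 1)%E.
  rewrite -[RHS](@integral_exponential_pdf R n.+2%:R)//.
  rewrite -[RHS](@integral_setD1 _ _ 0)//; last 2 first.
  - exact: measurableD.
  - by apply/measurable_EFinP/measurable_funTS;
      exact: measurable_exponential_pdf.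
  rewrite (@ge0_integral_affine _ _ 1 c)//; last first.
    by apply: measurableT_comp mPsi _; exact: measurable_funB.
  rewrite mul1e -[LHS](@integral_setD1 _ _ 0)//; last 2 first.
  - exact: measurableD.
  - apply: measurable_funTS; apply: measurableT_comp mPsi _;
      apply: measurable_funB => //.
    by apply: measurable_funD => //; exact: measurable_funM.
  apply: eq_integral => x /[!inE] -[_ /= /eqP x0].
  rewrite mul1r addrK /Psi; case: ltP => xp.
    by rewrite exponential_pdfE ?ltW// mulNr.
  by rewrite lt0_exponential_pdf// lt_neqAle x0.
pose K (z : R * (R * R)) :=
  (g z.2 * W (logr z.2.2) * Psi (z.1 - logr z.2.2)%R)%E.
have mlogr2 : measurable_fun [set: R * (R * R)] (fun z => logr z.2.2).
  by apply: measurableT_comp measurable_logr _; exact: measurableT_comp.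
have mK : measurable_fun [set: R * (R * R)] K.
  apply: emeasurable_funM; last first.
    by apply: measurableT_comp mPsi _; exact: measurable_funB.
  by apply: emeasurable_funM;
    [exact: measurableT_comp|exact: measurableT_comp mW _].
have K0 z : (0 <= K z)%E by rewrite !mule_ge0.
(* [J] is [K] after the dilation by [expR x], Jacobian [expR x ^+ n.+2] included. The argument of
   [Psi] becomes [x - (x + ln r) = - ln r], free of [x]. *)
pose J (z : R * (R * R)) := ((expR (n.+2%:R * z.1))%:E *
   W (z.1 + logr z.2.2)%R * (g z.2 * Psi (- logr z.2.2)%R))%E.
have mJ : measurable_fun [set: R * (R * R)] J.
  apply: emeasurable_funM; last first.
    apply: emeasurable_funM; first exact: measurableT_comp.
    by apply: measurableT_comp mPsi _; exact: measurableT_comp.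
  apply: emeasurable_funM; last by apply: measurableT_comp mW _;
    exact: measurable_funD.
  apply/measurable_EFinP; apply: measurableT_comp => //.
  by apply: measurable_funM => //; exact: measurable_fst.
have J0 z : (0 <= J z)%E by rewrite !mule_ge0// lee_fin expR_ge0.
transitivity (axial_int n.+1 (fun z => \int[mu]_x K (x, z))%E).
  congr axial_int; apply/funext => z.
  rewrite /K /= ge0_integralZl//.
  - by rewrite intPsi mule1.
  - by apply: measurableT_comp mPsi _; exact: measurable_funB.
  - by rewrite mule_ge0.
rewrite axial_int_swap//.
transitivity (\int[mu]_x axial_int n.+1 (fun z => J (x, z)))%E.
  apply: eq_integral => x _.
  have mKx : measurable_fun [set: R * R] (fun z => K (x, z)).
    apply: (measurableT_comp (g := fun z : R * R => (x, z)) mK).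
    exact: measurable_pair1.
  have mJx : measurable_fun [set: R * R] (fun z => J (x, z)).
    apply: (measurableT_comp (g := fun z : R * R => (x, z)) mJ).
    exact: measurable_pair1.
  have mKxs : measurable_fun [set: R * R] (fun z => K (x, (expR x *
    z.1, expR x ^+ 2 * z.2)%R)).
    apply: (measurableT_comp (g :=
      fun z : R * R => (expR x * z.1, expR x ^+ 2 * z.2))
      mKx).
    by apply: measurable_fun_pair => //=; exact: measurable_funM.
  rewrite (axial_int_scale _ mKx _ (expR_gt0 x))//.
  have c0 : (0 <= (expR x ^+ n.+2)%:E)%E
    by rewrite lee_fin exprn_ge0// expR_ge0.
  have [c cE] : exists c, c = (expR x ^+ n.+2)%:E by exists (expR x ^+ n.+2)%:E.
  rewrite -cE in c0 *.
  rewrite -(axial_intZl _ mKxs (fun z => K0 _) c0).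
  apply: eq_axial_int => //; first exact: emeasurable_funM.
  move=> a b b0; rewrite /K /J /= gs ?expR_gt0//.
  have -> : logr (expR x ^+ 2 * b) = x + logr b.
    by rewrite /logr half_ln_scale ?expR_gt0// expRK.
  rewrite opprD addrA subrr add0r cE -expRM_natl.
  rewrite -!muleA; congr (_ * _)%E; rewrite muleCA; congr (_ * _)%E.
rewrite -axial_int_swap//.
set I := (X in (_ * _ * X)%E).
have I0 : (0 <= I)%E by apply: integral_ge0 => x _;
  rewrite mule_ge0// lee_fin expR_ge0.
have mg01 : measurable_fun [set: R * R] (fun z => if
  (0 < z.2 < 1)%R then g z else 0%E).
  apply: measurable_fun_ifT => //.
  by apply: measurable_and => /=; exact: measurable_fun_ltr.
have NI0 : (0 <= (n.+2%:R)%:E * I)%E by rewrite mule_ge0// lee_fin.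
rewrite -muleA (muleC _ I) muleA -(axial_intZl _ mg01 _ NI0); last
  by move=> z; case: ifP.
apply: eq_axial_int.
- exact: (measurable_fun_fubini_tonelli_G (m1 := mu) J).
- exact: emeasurable_funM.
move=> a b b0; rewrite /J /=; set c := logr b.
have mWc : measurable_fun [set: R] (fun x => ((expR (n.+2%:R * x))%:E * W
  (x + c)%R)%E).
  apply: emeasurable_funM; last by apply: measurableT_comp mW _;
    exact: measurable_funD.
  by apply/measurable_EFinP; apply: measurableT_comp => //;
    exact: measurable_funM.
have mWI : measurable_fun [set: R] (fun x => ((expR (n.+2%:R * x))%:E * W x)%E).
  apply: emeasurable_funM => //.
  by apply/measurable_EFinP; apply: measurableT_comp => //;
    exact: measurable_funM.
have Wc0 x : (0 <= (expR (n.+2%:R * x))%:E * W (x + c)%R)%E.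
  by rewrite mule_ge0// lee_fin expR_ge0.
have WI0 x : (0 <= (expR (n.+2%:R * x))%:E * W x)%E.
  by rewrite mule_ge0// lee_fin expR_ge0.
rewrite ge0_integralZr//; last by rewrite mule_ge0.
(* Translating by [c = ln r] produces the factor [r^(n+2)], which [Psi (- c)] supplies inside the
   ball. *)
have -> : I = ((expR (n.+2%:R * c))%:E *
    \int[mu]_x ((expR (n.+2%:R * x))%:E * W (x + c)%R))%E.
  rewrite /I (@ge0_integral_affine _ _ 1 c mWI WI0 ltr01) mul1e.
  have e0 : (0 <= (expR (n.+2%:R * c))%:E)%E by rewrite lee_fin expR_ge0.
  rewrite -[RHS]ge0_integralZl; [|by []|exact: mWc|by move=> *;
    exact: Wc0|exact: e0].
  apply: eq_integral => x _; rewrite mul1r mulrDr expRD EFinM.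
  by rewrite -!muleA muleCA.
set V := (\int[mu]_x _)%E.
rewrite /Psi b0 /= oppr_gt0 mulrN opprK.
have -> : (c < 0) = (b < 1).
  by rewrite /c /logr pmulr_llt0// -[X in _ < X]ln1 ltr_ln ?posrE.
case: ifP => _; last by rewrite !mule0.
by rewrite EFinM (muleC V) [RHS]muleC !muleA.
Qed.

End AxialIntegral.

(** * Parabolic coordinates *)

Section Parabolic.
Context {R : realType}.
Local Notation mu := (@lebesgue_measure R).

Lemma sqrt_expR (b : R) : 0 < b -> Num.sqrt b = expR (ln b / 2).
Proof.
move=> b0; rewrite -[in LHS](@lnK _ b) ?posrE//.
rewrite -[X in Num.sqrt (expR X)](@divfK _ 2)// expRM_natr sqrtr_sqr.
by rewrite ger0_norm// expR_ge0.
Qed.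

(** With [t = (expR x - rho expR (- x)) / 2] and [r = sqrt (t^2 + rho)], one has
    [1 + t / r = expR x / r]. The powers of [r] cancel: [r^(- kappa)] from this base,
    [r^(kappa - 1)] from the weight, and [r] from [dt = r dx]. *)
Lemma parabolic_substitution (kappa rho : R) : 0 < rho ->
  (\int[mu]_t ((1 + t * expR (- (ln (t ^+ 2 + rho) / 2))) `^ kappa *
     expR ((kappa - 1) * (ln (t ^+ 2 + rho) / 2) - expR (ln
       (t ^+ 2 + rho) / 2)))%:E =
   \int[mu]_x (expR (kappa * x - (expR x + rho * expR (- x)) / 2))%:E)%E.
Proof.
move=> rho0.
pose F (x : R) := (expR x - rho * expR (- x)) / 2.
pose r (x : R) := (expR x + rho * expR (- x)) / 2.
have r0 x : 0 < r x by rewrite divr_gt0// addr_gt0 ?mulr_gt0// expR_gt0.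
have Fr x : F x ^+ 2 + rho = r x ^+ 2.
  by rewrite /F /r expRN; field; rewrite gt_eqF// expR_gt0.
have dF (x : R) : is_derive x (1 : R) F (r x).
  rewrite /F /r.
  have -> : (fun x => (expR x - rho * expR (- x)) / 2) =
            2^-1 *: (expR - rho *: (expR \o -%R)) :> (R -> R).
    by apply/funext => y; rewrite !fctE /= mulrC.
  apply: is_derive_eq; rewrite /GRing.scale /=; ring.
have F'r : F^`()%classic = r.
  by apply/funext => x; rewrite derive1E derive_val.
have Ds t : 0 < t ^+ 2 + rho by rewrite ltr_wpDl// sqr_ge0.
have Et t : expR (ln (t ^+ 2 + rho) / 2) = Num.sqrt (t ^+ 2 + rho).
  by rewrite sqrt_expR.
have tr t : 0 < Num.sqrt (t ^+ 2 + rho) + t.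
  have : `|t| < Num.sqrt (t ^+ 2 + rho) by rewrite -sqrtr_sqr ltr_sqrt// ltrDl.
  by rewrite ltr_norml => /andP[? _]; lra.
have rangeF : range F = [set: R].
  (* The preimage of [t] comes from solving [r + t = expR x] for [x]. *)
  apply/seteqP; split => // t _;
    exists (ln (Num.sqrt (t ^+ 2 + rho) + t)) => //.
  rewrite /F expRN lnK ?posrE//.
  move: (sqr_sqrtr (ltW (Ds t))) (tr t); move: (Num.sqrt _) => S sq S0.
  have -> : rho = S ^+ 2 - t ^+ 2 by rewrite sq; ring.
  by field; rewrite gt_eqF.
rewrite -[in LHS]rangeF.
rewrite (@ge0_integration_by_substitution_range _ F (fun t : R => (1 + t *
  expR (- (ln (t ^+ 2 + rho) / 2))) `^ kappa *
     expR ((kappa - 1) * (ln (t ^+ 2 + rho) / 2) - expR (ln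
       (t ^+ 2 + rho) / 2)))).
- apply: eq_integral => x _; congr (_%:E); rewrite F'r Fr.
  have -> : ln (r x ^+ 2) / 2 = ln (r x) by rewrite lnXn//; field.
  rewrite expRN lnK ?posrE//.
  have -> : 1 + F x / r x = expR (x - ln (r x)).
    rewrite expRB lnK ?posrE//.
    have <- : F x + r x = expR x by rewrite /F /r; field.
    by field; rewrite gt_eqF.
  rewrite -expRM -[X in _ * X](@lnK _ (r x)) ?posrE// -!expRD; congr expR.
  by rewrite -/(r x); ring.
- move=> x y xy;
    rewrite /F ltr_pM2r// ltrB// ?ltr_expR// ltr_pM2l// ltr_expR ltrN2//.
- by move=> x; exact: ex_derive.
- rewrite F'r /r => x; apply: cvgM; last exact: cvg_cst.
  apply: cvgD; first exact: continuous_expR.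
  apply: cvgM; first exact: cvg_cst.
  by apply: (@continuous_comp _ _ _ -%R expR);
    [exact: opp_continuous|exact: continuous_expR].
- move=> t _.
  have cln : {for t, continuous (fun t : R => ln (t ^+ 2 + rho) / 2)}.
    have cl : {for t, continuous (fun t : R => ln (t ^+ 2 + rho))}.
      have cq : {for t, continuous (fun t : R => t ^+ 2 + rho)}.
        by apply: cvgD; [exact: exprn_continuous|exact: cvg_cst].
      by apply: (@continuous_comp _ _ _ _ (@ln R) t cq); exact: continuous_ln.
    by apply: cvgM; [exact: cl|exact: cvg_cst].
  have cE (u : R -> R) : {for t, continuous u} ->
    {for t, continuous (fun t => expR (u t))}.
    by move=> cu; apply: (@continuous_comp _ _ _ u expR) => //;
      exact: continuous_expR.
  have cp : {for t, continuous
      (fun t : R => (1 + t * expR (- (ln (t ^+ 2 + rho) / 2))) `^ kappa)}.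
    have cb : {for t, continuous (fun t : R => 1 + t * expR (- (ln
      (t ^+ 2 + rho) / 2)))}.
      apply: cvgD; first exact: cvg_cst.
      apply: cvgM; first exact: cvg_id.
      by apply: (cE (fun t : R => - (ln (t ^+ 2 + rho) / 2))); exact: cvgN.
    apply: (@continuous_comp _ _ _ _ (@powR R ^~ kappa) t cb).
    (* Differentiability of the power is used at a positive base: with [S = sqrt (t^2 + rho)] the
       base is [(S + t) / S], and [tr] gives [0 < S + t]. *)
    apply/differentiable_continuous/derivable1_diffP; apply: derivable_powR.
    rewrite in_itv /= andbT expRN Et.
    have s0 : Num.sqrt (t ^+ 2 + rho) != 0 by rewrite gt_eqF// sqrtr_gt0.
    by rewrite -[X in X + _](divff s0) -mulrDl divr_gt0// sqrtr_gt0.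
  apply: cvgM; first exact: cp.
  apply: (cE (fun t : R => (kappa - 1) * (ln (t ^+ 2 + rho) / 2) - expR (ln
    (t ^+ 2 + rho) / 2))).
  apply: cvgB; last exact: (cE _ cln).
  by apply: cvgM; [exact: cvg_cst|exact: cln].
- by move=> t; rewrite mulr_ge0 ?powR_ge0 ?expR_ge0.
Qed.

End Parabolic.

(** * The normalizing constant of the Power Spherical density *)

Section PowerSpherical.
Context {R : realType}.
Local Notation mu := (@lebesgue_measure R).
Variable kappa : R.

(* [(1 + a / sqrt b) `^ kappa] at [z = (a, b)], for [0 < b]. *)
Let profile (z : R * R) : \bar R :=
  ((1 + z.1 * expR (- (ln z.2 / 2))) `^ kappa)%:E.
(** At [x = ln r] this is [r^(kappa - 1) expR (- r)]; the exponent is the one for which the powers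
    of [r] cancel in [parabolic_substitution]. *)
Let weight (x : R) : \bar R := (expR ((kappa - 1) * x - expR x))%:E.

Let measurable_profile : measurable_fun [set: R * R] profile.
Proof.
have mb : measurable_fun [set: R * R] (fun z => 1 + z.1 * expR (-
  (ln z.2 / 2))).
  apply: measurable_funD => //; apply: measurable_funM => //.
  apply: measurableT_comp => //; apply: measurableT_comp => //.
  by apply: measurable_funM => //; apply: measurableT_comp => //;
    exact: measurable_ln.
by apply/measurable_EFinP; exact: (measurableT_comp (measurable_powR kappa) mb).
Qed.

Let measurable_weight : measurable_fun [set: R] weight.
Proof. exact: measurable_expRB. Qed.

Let profile_ge0 z : (0 <= profile z)%E. Proof. by rewrite lee_fin powR_ge0. Qed.
Let weight_ge0 x : (0 <= weight x)%E. Proof. by rewrite lee_fin expR_ge0. Qed.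

Let profile_scale s a b : 0 < s -> 0 < b ->
  profile (s * a, s ^+ 2 * b) = profile (a, b).
Proof.
move=> s0 b0; rewrite /profile /= (half_ln_scale s0 b0).
rewrite opprD expRD (expRN (ln s)) lnK ?posrE//; congr (((_ + _) `^ _)%:E).
by field; rewrite gt_eqF.
Qed.

(** Exchanging integrals puts the axis integral innermost, where [parabolic_substitution] applies
    with [rho = |y|^2]. After exchanging back, the integral over [y] is Gaussian with rate
    [expR (- x) / 2]. *)
Lemma axial_int_profile_weight n :
  axial_int n.+1 (fun z => profile z * weight (ln z.2 / 2)%R)%E =
  ((Num.sqrt (2 * pi) ^+ n.+1 * 2 `^ (n.+1%:R / 2 + kappa))%:E *
    expGamma (n.+1%:R / 2 + kappa))%E.
Proof.
set k := (fun z => _).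
have mk : measurable_fun [set: R * R] k.
  apply: emeasurable_funM => //; apply: measurableT_comp measurable_weight _.
  by apply: measurable_funM => //; apply: measurableT_comp => //;
    exact: measurable_ln.
have k0 z : (0 <= k z)%E by rewrite mule_ge0.
(* With the offset [t^2] moved into [kt], the iteration starts at 0 for every [t], which permits the
   exchange. *)
pose kt (z : R * R) := k (z.1, z.2 + z.1 ^+ 2).
have mkt : measurable_fun [set: R * R] kt.
  apply: (measurableT_comp (g := fun z : R * R => (z.1, z.2 + z.1 ^+ 2)) mk).
  apply: measurable_fun_pair => //=; apply: measurable_funD => //.
  by apply: measurable_funX.
pose j (z : R * R) : \bar R :=
  (expR (kappa * z.1 - (expR z.1 + z.2 * expR (- z.1)) / 2))%:E.
have mj : measurable_fun [set: R * R] j.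
  apply/measurable_EFinP; apply: measurableT_comp => //; apply: measurable_funB.
    exact: measurable_funM.
  apply: measurable_funM => //; apply: measurable_funD;
    first exact: measurableT_comp.
  apply: measurable_funM => //; apply: measurableT_comp => //;
    exact: measurableT_comp.
have j0 z : (0 <= j z)%E by rewrite lee_fin expR_ge0.
transitivity (\int[mu]_t iter n.+1 sqint (fun b => kt (t, b)) 0%R)%E.
  apply: eq_integral => t _.
  rewrite -{1}(add0r (t ^+ 2)).
  exact/esym/(sqint_translate n.+1 (fun b => k (t, b)) (t ^+ 2) 0).
rewrite -(sqint_swap n.+1 0 mkt (fun z => k0 _)).
transitivity (iter n.+1 sqint (fun b => \int[mu]_x j (x, b))%E 0).
  apply: eq_sqint_gt0 => //.
  - exact: (measurable_fun_fubini_tonelli_G (m1 := mu) kt mkt (fun z => k0 _)).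
  - exact: (measurable_fun_fubini_tonelli_G (m1 := mu) j mj j0).
  - move=> b b0; apply: etrans (parabolic_substitution kappa b0).
    apply: eq_integral => t _.
    by rewrite /kt /k /profile /weight /= -EFinM (addrC b).
rewrite sqint_swap//.
(* The factor [1 / 2] in front of [expR x] yields the power of 2, through [expGamma_scale]. *)
have c0 : 0 < 2^-1 :> R by rewrite invr_gt0.
set a := n.+1%:R / 2 + kappa.
have -> : 2 `^ a = 2^-1 `^ (- a) by rewrite -powR_inv1// -powRrM mulN1r opprK.
rewrite EFinM -muleA -expGamma_scale// -[RHS]ge0_integralZl//; last first.
  by apply: measurable_expRB; exact: measurable_funM.
apply: eq_integral => x _.
have ex0 : 0 < expR (- x) / 2 by rewrite divr_gt0// expR_gt0.
transitivity (iter n.+1 sqint (fun b => (expR (kappa * x - expR x / 2))%:E *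
    (expR (- (expR (- x) / 2 * b)))%:E)%E 0%R).
  congr (iter _ _ _ _); apply/funext => b; rewrite /j -EFinM -expRD.
  by congr ((expR _)%:E); rewrite /=; field.
rewrite (@sqintZl _ n.+1 (fun b => (expR (- (expR (- x) / 2 * b)))%:E))//;
  last first.
  apply/measurable_EFinP; apply: measurableT_comp => //;
    apply: measurableT_comp => //.
rewrite sqint_expR// mulr0 oppr0 expR0 mulr1 -!EFinM; congr (_%:E).
have -> : pi / (expR (- x) / 2) = 2 * pi * expR x.
  by rewrite expRN; field; rewrite gt_eqF// expR_gt0.
rewrite sqrtrM ?mulr_ge0 ?pi_ge0// (sqrt_expR
  (expR_gt0 x)) expRK exprMn -expRM_natl.
rewrite mulrC -mulrA -expRD; congr (_ * expR _).
by rewrite /a; field.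
Qed.

(** In [radial_factorization] the left side is known from [axial_int_profile_weight], and the right
    side is the wanted ball integral times [Gamma (a + b)], which is positive and can be divided
    out. *)
Lemma axial_int_profile n :
  let a := n.+1%:R / 2 + kappa in
  let b := n.+1%:R / 2 in
  0 <= kappa ->
  ((n.+2%:R)%:E * axial_int n.+1 (fun z => if
    (0 < z.2 < 1)%R then profile z else 0) =
   (2 `^ (a + b) * pi `^ b * (Gamma a / Gamma (a + b)))%:E)%E.
Proof.
move=> a b kappa0.
have b0 : 0 < b by rewrite divr_gt0.
have a0 : 0 < a by rewrite ltr_wpDr.
have ab0 : 0 < a + b by rewrite addr_gt0.
have := radial_factorization n measurable_profile profile_ge0 profile_scale
  measurable_weight weight_ge0.
rewrite axial_int_profile_weight -/a -/b.
(* The exponents add up: [n.+2 + (kappa - 1) = a + b]. *)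
have -> : (\int[mu]_x ((expR (n.+2%:R * x))%:E * weight x) =
  expGamma (a + b))%E.
  apply: eq_integral => x _; rewrite -EFinM -expRD; congr ((expR _)%:E).
  by rewrite /a /b -(natr1 n.+1); field.
rewrite -!EFin_Gamma// => H.
have G0 : 0 < Gamma (a + b) by exact: Gamma_gt0.
transitivity ((n.+2%:R)%:E * axial_int n.+1 (fun z => if
  (0 < z.2 < 1)%R then profile z else 0)
   * (Gamma (a + b))%:E * (Gamma (a + b))^-1%:E)%E.
  by rewrite -muleA -EFinM divff ?gt_eqF// mule1.
rewrite -H -!EFinM; congr (_%:E).
(* The Gaussian factor is [2 pi] to the power [b]; its part [2^b] completes [2^a] to [2^(a + b)]. *)
rewrite -[Num.sqrt _]powR12_sqrt ?mulr_ge0 ?pi_ge0//.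
rewrite -powR_mulrn ?powR_ge0// -powRrM.
rewrite mulrC powRM ?pi_ge0// -/b.
rewrite (mulrC 2^-1) -/b.
have -> : 2 `^ (a + b) = 2 `^ a * 2 `^ b
  by rewrite (@powRD _ _ a b) ?pnatr_eq0 ?implybT.
by move: (2 `^ a) (Gamma a) (Gamma (a + b))^-1 => A G Gi; ring.
Qed.

(** The constant [C] lets one computation serve both the unnormalized integral and the density. *)
Lemma sphere_int_power n (m : 'rV[R]_n.+2) (C : R) :
  enorm m = 1 -> 0 <= kappa -> 0 <= C ->
  sphere_int (fun x => C * ps_unnorm m kappa x) = (C * ps_const n.+2 kappa)%:E.
Proof.
move=> m1 kappa0 C0.
pose A (z : R * R) := (if (0 < z.2 < 1)%R then profile z else 0)%E.
have mA : measurable_fun [set: R * R] A.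
  apply: measurable_fun_ifT => //.
  by apply: measurable_and => /=; exact: measurable_fun_ltr.
have A0 z : (0 <= A z)%E by rewrite /A; case: ifP.
have mCA : measurable_fun [set: R * R] (fun z => C%:E * A z)%E
  by exact: emeasurable_funM.
have CE0 : (0 <= C%:E)%E by rewrite lee_fin.
have CA0 z : (0 <= C%:E * A z)%E by rewrite mule_ge0.
rewrite /sphere_int /lebesgue_int_Rd.
(* [inord] turns the row into a sequence indexed by [nat], as in [iint_rotation]; the sums only see
   indices below [n.+2]. *)
pose m_ i := m ord0 (inord i).
transitivity ((n.+2%:R)%:E * iint n.+2 (fun x =>
   C%:E * A (\sum_(i < n.+2) m_ i * x i, \sum_(i < n.+2) x i ^+ 2)%R))%E.
  congr (_ * iint _ _)%E; apply/funext => x.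
  set S := \sum_(i < n.+2) x i ^+ 2.
  have SE : enorm (\row_(i < n.+2) x i) = Num.sqrt S.
    by rewrite /enorm /dotv; congr (Num.sqrt _); apply: eq_bigr => i _;
      rewrite !mxE expr2.
  rewrite SE /A /= sqrtr_gt0 -{1}sqrtr1 ltr_sqrt//.
  case: ifP => [/andP[S0 S1]|_]; last by rewrite mule0.
  rewrite -EFinM /ps_unnorm; congr ((_ * (1 + _) `^ _)%:E).
  rewrite expRN -sqrt_expR// mulr_suml; apply: eq_bigr => i _.
  by rewrite !mxE /m_ inord_val; ring.
rewrite (iint_rotation n.+1 m_ mCA CA0).
have -> : Num.sqrt (\sum_(i < n.+2) m_ i ^+ 2) = 1.
  rewrite -m1 /enorm /dotv; congr (Num.sqrt _); apply: eq_bigr => i _.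
  by rewrite /m_ inord_val expr2.
under eq_integral => t _ do rewrite mul1r.
rewrite -[X in (_ * X)%E]/(axial_int n.+1 (fun z => C%:E * A z)%E).
rewrite (axial_intZl n.+1 mA A0 CE0) muleCA EFinM; congr (_ * _)%E.
rewrite [LHS](axial_int_profile n kappa0) /ps_const.
by have -> : n.+2%:R - 1 = n.+1%:R :> R by rewrite -natr1 addrK.
Qed.

Lemma ps_const_gt0 n : 0 <= kappa -> 0 < ps_const n.+2 kappa.
Proof.
move=> kappa0; rewrite /ps_const.
have -> : n.+2%:R - 1 = n.+1%:R :> R by rewrite -natr1 addrK.
have b0 : 0 < n.+1%:R / 2 :> R by rewrite divr_gt0.
have a0 : 0 < n.+1%:R / 2 + kappa by rewrite ltr_wpDr.
apply: mulr_gt0; first by rewrite mulr_gt0 ?powR_gt0 ?pi_gt0.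
by apply: divr_gt0; apply: Gamma_gt0 => //; exact: addr_gt0.
Qed.

End PowerSpherical.

Theorem theorem13 (R : realType) (d : nat) (mu : 'rV[R]_d) (kappa : R) :
  (2 <= d)%N -> enorm mu = 1 -> 0 <= kappa ->
  sphere_int (ps_unnorm mu kappa) = (ps_const d kappa)%:E /\
  sphere_int (ps_density mu kappa) = 1%E.
Proof.
case: d mu => [//|[//|n]] mu _ mu1 kappa0; split.
  (* The two claims are the cases [C = 1] and [C = (ps_const n.+2 kappa)^-1]. *)
  rewrite -[ps_const _ _]mul1r -(sphere_int_power mu1 kappa0 ler01).
  by congr sphere_int; apply/funext => x; rewrite mul1r.
have c0 := ps_const_gt0 n kappa0.
rewrite [LHS](sphere_int_power mu1 kappa0) ?invr_ge0 ?(ltW c0)//.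
by rewrite mulVf// gt_eqF.
Qed.
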